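(* If $\varphi\in\mathcal L_\Diamond$ and ${\sf ITL}^0_\Diamond\not\vdash\varphi$, then $\varphi$ is falsified on some finite $\mathrm{sub}(\varphi)$-quasimodel, i.e. there is a finite $\mathrm{sub}(\varphi)$-quasimodel $\mathcal Q$ and $w\in|\mathcal Q|$ with $\varphi\in\ell^-_{\mathcal Q}(w)$.
   Context: $\mathcal L_\Diamond$ is the propositional language with $\bot,\wedge,\vee,\to$ and unary modalities $\bigcirc$, $\Diamond$; $\mathrm{sub}(\varphi)$ is the set of subformulas of $\varphi$. ${\sf ITL}^0_\Diamond$ is the least set of formulas containing all intuitionistic propositional tautologies and $\neg\bigcirc\bot$, $\bigcirc\varphi\wedge\bigcirc\psi\to\bigcirc(\varphi\wedge\psi)$, $\bigcirc(\varphi\vee\psi)\to\bigcirc\varphi\vee\bigcirc\psi$, $\bigcirc(\varphi\to\psi)\to(\bigcirc\varphi\to\bigcirc\psi)$, $\varphi\vee\bigcirc\Diamond\varphi\to\Diamond\varphi$, closed under modus ponens and the rules $\varphi/\bigcirc\varphi$, $(\varphi\to\psi)/(\Diamond\varphi\to\Diamond\psi)$, $(\bigcirc\varphi\to\varphi)/(\Diamond\varphi\to\varphi)$. For $\Sigma$ closed under subformulas, a $\Sigma$-type is a pair $\Phi=(\Phi^-;\Phi^+)$ of subsets of $\Sigma$ with $\Phi^-\cap\Phi^+=\varnothing$, $\Phi^-\cup\Phi^+=\Sigma$, $\bot\notin\Phi^+$, for $\varphi\wedge\psi\in\Sigma$: $\varphi\wedge\psi\in\Phi^+$ iff $\varphi,\psi\in\Phi^+$;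 for $\varphi\vee\psi\in\Sigma$: $\varphi\vee\psi\in\Phi^+$ iff $\varphi\in\Phi^+$ or $\psi\in\Phi^+$; if $\varphi\to\psi\in\Phi^+$ then $\varphi\in\Phi^-$ or $\psi\in\Phi^+$; if $\Diamond\varphi\in\Phi^-$ then $\varphi\in\Phi^-$. $\Phi\preccurlyeq_T\Psi$ iff $\Phi^+\subseteq\Psi^+$. $\Phi\,S_T\,\Psi$ iff: $\bigcirc\varphi\in\Phi^+\Rightarrow\varphi\in\Psi^+$; $\bigcirc\varphi\in\Phi^-\Rightarrow\varphi\in\Psi^-$; ($\Diamond\varphi\in\Phi^+$, $\varphi\in\Phi^-$)$\Rightarrow\Diamond\varphi\in\Psi^+$; $\Diamond\varphi\in\Phi^-\Rightarrow\Diamond\varphi\in\Psi^-$. A $\Sigma$-quasimodel is $(W,\preccurlyeq,S,\ell)$ where $\preccurlyeq$ is a partial order on $W$, $\ell$ maps $W$ to $\Sigma$-types with $w\preccurlyeq v\Rightarrow\ell(w)\preccurlyeq_T\ell(v)$, and whenever $\varphi\to\psi\in\ell^-(w)$ there is $v\succcurlyeq w$ with $\varphi\in\ell^+(v)$, $\psi\in\ell^-(v)$; and $S\subseteq W\times W$ is serial, forward-confluent (if $w\preccurlyeq w'$ and $w\,S\,v$ then some $v'\succcurlyeq v$ has $w'\,S\,v'$), sensible ($w\,S\,v\Rightarrow\ell(w)\,S_T\,\ell(v)$), and $\omega$-sensible (if $\Diamond\varphi\in\ell^+(w)$ then there are $n\ge0$ and $v$ with $w\,S^n\,v$ and $\varphi\in\ell^+(v)$).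 *)

(* Defs.v *)
From Stdlib Require Import List.
Import ListNotations.

Inductive form : Type :=
| Var : nat -> form
| Bot : form
| And : form -> form -> form
| Or  : form -> form -> form
| Imp : form -> form -> form
| Next : form -> form
| Dia : form -> form.

Definition Neg (a : form) : form := Imp a Bot.

Fixpoint sub (f : form) : list form :=
  f :: match f with
       | Var _ | Bot => []
       | And a b | Or a b | Imp a b => sub a ++ sub b
       | Next a | Dia a => sub a
       end.

(* ITL^0_◇ as a Hilbert calculus. The intuitionistic propositional
   tautologies (all substitution instances in L_◇) are generated by the
   standard IPC axiom schemes together with modus ponens. *)
Inductive ITL0 : form -> Prop :=
| ipc1 a b : ITL0 (Imp a (Imp b a))
| ipc2 a b c : ITL0 (Imp (Imp a (Imp b c)) (Imp (Imp a b) (Imp a c)))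
| ipc3 a b : ITL0 (Imp (And a b) a)
| ipc4 a b : ITL0 (Imp (And a b) b)
| ipc5 a b : ITL0 (Imp a (Imp b (And a b)))
| ipc6 a b : ITL0 (Imp a (Or a b))
| ipc7 a b : ITL0 (Imp b (Or a b))
| ipc8 a b c : ITL0 (Imp (Imp a c) (Imp (Imp b c) (Imp (Or a b) c)))
| ipc9 a : ITL0 (Imp Bot a)
| ax_nextbot : ITL0 (Neg (Next Bot))
| ax_nextand a b : ITL0 (Imp (And (Next a) (Next b)) (Next (And a b)))
| ax_nextor a b : ITL0 (Imp (Next (Or a b)) (Or (Next a) (Next b)))
| ax_nextimp a b : ITL0 (Imp (Next (Imp a b)) (Imp (Next a) (Next b)))
| ax_diafix a : ITL0 (Imp (Or a (Next (Dia a))) (Dia a))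
| r_mp a b : ITL0 (Imp a b) -> ITL0 a -> ITL0 b
| r_nec a : ITL0 a -> ITL0 (Next a)
| r_diamono a b : ITL0 (Imp a b) -> ITL0 (Imp (Dia a) (Dia b))
| r_diaind a : ITL0 (Imp (Next a) a) -> ITL0 (Imp (Dia a) a).

Record is_type (Sig : list form) (Pm Pp : form -> Prop) : Prop := {
  ty_minus_sub : forall f, Pm f -> In f Sig;
  ty_plus_sub  : forall f, Pp f -> In f Sig;
  ty_disj  : forall f, ~ (Pm f /\ Pp f);
  ty_cover : forall f, In f Sig -> Pm f \/ Pp f;
  ty_bot   : ~ Pp Bot;
  ty_and   : forall a b, In (And a b) Sig -> (Pp (And a b) <-> Pp a /\ Pp b);
  ty_or    : forall a b, In (Or a b) Sig -> (Pp (Or a b) <-> Pp a \/ Pp b);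
  ty_imp   : forall a b, Pp (Imp a b) -> Pm a \/ Pp b;
  ty_dia   : forall a, Pm (Dia a) -> Pm a
}.

Definition sens_T (Pm Pp Qm Qp : form -> Prop) : Prop :=
  (forall a, Pp (Next a) -> Qp a) /\
  (forall a, Pm (Next a) -> Qm a) /\
  (forall a, Pp (Dia a) -> Pm a -> Qp (Dia a)) /\
  (forall a, Pm (Dia a) -> Qm (Dia a)).

Fixpoint iter_rel {W : Type} (S : W -> W -> Prop) (n : nat) : W -> W -> Prop :=
  match n with
  | O => fun w v => w = v
  | Datatypes.S m => fun w v => exists u, S w u /\ iter_rel S m u v
  end.

(* A Σ-quasimodel on carrier W: le is ≼, S the successor relation,
   lm/lp the two components ℓ^-/ℓ^+ of the labelling. *)
Record quasimodel (Sig : list form) (W : Type)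
  (le S : W -> W -> Prop) (lm lp : W -> form -> Prop) : Prop := {
  qm_refl  : forall w, le w w;
  qm_trans : forall u v w, le u v -> le v w -> le u w;
  qm_antisym : forall u v, le u v -> le v u -> u = v;
  qm_type  : forall w, is_type Sig (lm w) (lp w);
  qm_mono  : forall w v f, le w v -> lp w f -> lp v f;
  qm_imp   : forall w a b, lm w (Imp a b) ->
               exists v, le w v /\ lp v a /\ lm v b;
  qm_serial : forall w, exists v, S w v;
  qm_fconf  : forall w w' v, le w w' -> S w v ->
               exists v', le v v' /\ S w' v';
  qm_sens   : forall w v, S w v -> sens_T (lm w) (lp w) (lm v) (lp v);
  qm_omega  : forall w a, lp w (Dia a) ->
               exists n v, iter_rel S n w v /\ lp v a
}.

Definition finite_type (W : Type) : Prop :=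
  exists l : list W, forall w, In w l.

(* Main.v *)
(** The quasimodel approximates the canonical model of prime
    theories.  A point is a finite tree of [Sigma]-types whose labels strictly
    grow from parent to child, so there are only finitely many.  A prime theory
    [G] simulates a tree if [G] has the type at the root and every child is
    simulated by a prime extension of [G].  Each tree [t] has a characteristic
    formula [chi t] which is refuted by [G] iff some prime extension of [G]
    simulates [t].  Among the trees simulated by [G] there is one having as
    children all the trees allowed by strict growth; these saturated trees let
    a simulated tree be followed along the successor map of the canonical
    model.  For omega-sensibility, let [psi] be the conjunction of [chi v] over
    the [v] reachable from [w].  Following simulated trees shows that
    [Next psi -> psi] is a theorem, hence so is [Dia psi -> psi].  If [a] fails
    at all reachable [v], then [a -> psi] is a theorem as well, so that
    [Dia a -> psi] is one; but a theory simulating [w] refutes [psi]. *)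

Require Import Defs.
From Stdlib Require Import List.
From Stdlib Require Import Arith Lia Cantor Classical ProofIrrelevance.
Import ListNotations.

(** * Derivability and prime theories *)

(** Hypotheses enter only modus ponens; necessitation and the rules for [Dia] apply to theorems
    alone. The deduction theorem rests on this. *)
Inductive der (G : form -> Prop) : form -> Prop :=
| der_hyp a : G a -> der G a
| der_thm a : ITL0 a -> der G a
| der_mp a b : der G (Imp a b) -> der G a -> der G b.

Definition add (G : form -> Prop) (a : form) : form -> Prop :=
  fun f => G f \/ f = a.

Lemma der_mono (G H : form -> Prop) :
  (forall f, G f -> H f) -> forall f, der G f -> der H f.
Proof.
  intros GH f D. induction D as [f Hf|f Hf|f g _ IH1 _ IH2].
  - apply der_hyp; auto.
  - apply der_thm; auto.
  - eapply der_mp; eauto.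
Qed.

Lemma der_empty f : der (fun _ => False) f -> ITL0 f.
Proof.
  intros D. induction D as [f Hf|f Hf|f g _ IH1 _ IH2].
  - contradiction.
  - assumption.
  - eapply r_mp; eauto.
Qed.

Lemma der_weaken G a b : der G b -> der G (Imp a b).
Proof. intros D. apply der_mp with (1 := der_thm _ _ (ipc1 b a)) (2 := D). Qed.

Lemma deduction G a b : der (add G a) b -> der G (Imp a b).
Proof.
  intros D. induction D as [f [Hf | ->]|f Hf|f g _ IH1 _ IH2].
  - apply der_weaken, der_hyp, Hf.
  - apply der_thm. eapply r_mp; [eapply r_mp|]; [apply ipc2| |].
    + apply (ipc1 a (Imp a a)).
    + apply ipc1.
  - apply der_weaken, der_thm, Hf.
  - eapply der_mp; [eapply der_mp|]; [apply der_thm, ipc2 | exact IH1 | exact IH2].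
Qed.

Lemma der_add G a : der (add G a) a.
Proof. apply der_hyp; right; reflexivity. Qed.

Lemma der_or_elim G a b c :
  der (add G a) c -> der (add G b) c -> der G (Or a b) -> der G c.
Proof.
  intros Da Db Dab.
  eapply der_mp; [|exact Dab].
  eapply der_mp; [|apply deduction, Db].
  eapply der_mp; [|apply deduction, Da].
  apply der_thm, ipc8.
Qed.

Record prime (G : form -> Prop) : Prop := {
  prime_closed : forall f, der G f -> G f;
  prime_bot : ~ G Bot;
  prime_or : forall a b, G (Or a b) -> G a \/ G b
}.

(** * Extension to prime theories *)

Fixpoint code (f : form) : nat :=
  match f with
  | Var n => to_nat (0, n)
  | Bot => to_nat (1, 0)
  | And a b => to_nat (2, to_nat (code a, code b))
  | Or a b => to_nat (3, to_nat (code a, code b))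
  | Imp a b => to_nat (4, to_nat (code a, code b))
  | Next a => to_nat (5, code a)
  | Dia a => to_nat (6, code a)
  end.

Lemma code_inj f g : code f = code g -> f = g.
Proof.
  revert g; induction f; intros [] E; cbn [code] in E;
    apply to_nat_inj in E; try discriminate; try reflexivity; apply (f_equal snd) in E; cbn [snd] in E;
    try (apply to_nat_inj in E; injection E as E1 E2);
    f_equal; auto.
Qed.

(** [code] replaces an enumeration of formulas: stage [n] decides the only
    formula, if any, whose code is [n]. *)
Fixpoint stage (G : form -> Prop) (a : form) (n : nat) : form -> Prop :=
  match n with
  | 0 => G
  | S n => fun f =>
      stage G a n f \/ (code f = n /\ ~ der (add (stage G a n) f) a)
  end.

Lemma stage_le G a m n : m <= n -> forall f, stage G a m f -> stage G a n f.
Proof. induction 1; simpl; auto. Qed.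

(** As [code] is injective, a stage adds at most one formula, and that formula has passed the
    test. *)
Lemma stage_avoids G a : ~ der G a -> forall n, ~ der (stage G a n) a.
Proof.
  intros H n; induction n as [|n IH]; [exact H|]; intros D.
  destruct (classic (exists f, code f = n /\ ~ der (add (stage G a n) f) a))
    as [(f & Ef & Hf)|N].
  - apply Hf. revert D; apply der_mono. simpl; intros g [Hg|[Eg _]].
    + left; exact Hg.
    + right; apply code_inj; congruence.
  - apply IH. revert D; apply der_mono. simpl; intros g [Hg|Hg]; [exact Hg|].
    exfalso; eauto.
Qed.

(** Compactness: a derivation uses finitely many hypotheses, all present from some stage on. *)
Lemma der_union_stage G a f :
  der (fun g => exists n, stage G a n g) f -> exists n, der (stage G a n) f.
Proof.
  intros D. induction D as [f [n Hf]|f Hf|f g _ [m IH1] _ [n IH2]].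
  - exists n; apply der_hyp, Hf.
  - exists 0; apply der_thm, Hf.
  - exists (max m n); eapply der_mp.
    + eapply der_mono; [|exact IH1]. apply stage_le; lia.
    + eapply der_mono; [|exact IH2]. apply stage_le; lia.
Qed.

Lemma lindenbaum G a : ~ der G a ->
  exists H, prime H /\ (forall f, G f -> H f) /\ ~ H a.
Proof.
  intros Ha. set (H := fun g => exists n, stage G a n g).
  assert (Av : ~ der H a).
  { intros D. apply der_union_stage in D as [n D].
    exact (stage_avoids G a Ha n D). }
  (* [f] is tested at stage [code f] against a subset of [H], so passing over [H] implies passing
     there. *)
  assert (Max : forall f, ~ der (add H f) a -> H f).
  { intros f Hf. exists (S (code f)); right; split; [reflexivity|].
    intros D; apply Hf. revert D; apply der_mono.
    intros g [Hg| ->]; [left; exists (code f); exact Hg | right; reflexivity]. }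
  exists H; split; [split|split].
  - intros f D. apply Max; intros Df. apply Av.
    eapply der_mp; [apply deduction, Df | exact D].
  - intros Hb. apply Av. eapply der_mp; [apply der_thm, ipc9 | apply der_hyp, Hb].
  - intros f g Hfg. apply NNPP; intros N. apply Av.
    (* By [Max], a disjunct outside [H] yields [a] once added; if both were outside, [H] would
       derive [a]. *)
    apply der_or_elim with f g.
    + apply NNPP; intros D; apply N; left; auto.
    + apply NNPP; intros D; apply N; right; auto.
    + apply der_hyp, Hfg.
  - intros f Hf; exists 0; exact Hf.
  - intros Hh; apply Av, der_hyp, Hh.
Qed.

(** Replaces Hilbert derivations by reasoning about membership in prime theories. *)
Lemma completeness f : (forall G, prime G -> G f) -> ITL0 f.
Proof.
  intros H. apply der_empty, NNPP; intros D.
  destruct (lindenbaum _ _ D) as (G & PG & _ & N). apply N, H, PG.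
Qed.

Lemma prime_thm G f : prime G -> ITL0 f -> G f.
Proof. intros P H; apply (prime_closed _ P), der_thm, H. Qed.

Lemma prime_mp G a b : prime G -> G (Imp a b) -> G a -> G b.
Proof.
  intros P Hab Ha; apply (prime_closed _ P).
  eapply der_mp; apply der_hyp; eauto.
Qed.

Lemma prime_thm_mp G a b : prime G -> ITL0 (Imp a b) -> G a -> G b.
Proof. intros P H; apply prime_mp; [exact P | apply prime_thm; auto]. Qed.

Lemma prime_and_iff G a b : prime G -> (G (And a b) <-> G a /\ G b).
Proof.
  intros P; split; [intros H; split|intros [Ha Hb]].
  - eapply prime_thm_mp; [exact P | apply ipc3 | exact H].
  - eapply prime_thm_mp; [exact P | apply ipc4 | exact H].
  - eapply prime_mp; [exact P | | exact Hb].
    eapply prime_thm_mp; [exact P | apply ipc5 | exact Ha].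
Qed.

Lemma prime_or_iff G a b : prime G -> (G (Or a b) <-> G a \/ G b).
Proof.
  intros P; split; [apply (prime_or _ P)|intros [H|H]].
  - eapply prime_thm_mp; [exact P | apply ipc6 | exact H].
  - eapply prime_thm_mp; [exact P | apply ipc7 | exact H].
Qed.

Lemma prime_not_imp G a b : prime G -> ~ G (Imp a b) ->
  exists H, prime H /\ (forall f, G f -> H f) /\ H a /\ ~ H b.
Proof.
  intros P N.
  destruct (lindenbaum (add G a) b) as (H & PH & GH & Hb).
  - intros D; apply N, (prime_closed _ P), deduction, D.
  - exists H; split; [exact PH | split; [|split; [|exact Hb]]].
    + intros f Hf; apply GH; left; exact Hf.
    + apply GH; right; reflexivity.
Qed.

(** * Derived theorems and the canonical successor *)

Lemma ITL0_trans a b c : ITL0 (Imp a b) -> ITL0 (Imp b c) -> ITL0 (Imp a c).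
Proof.
  intros Hab Hbc; apply completeness; intros G P.
  apply (prime_closed _ P), deduction.
  eapply der_mp; [apply der_thm, Hbc|].
  eapply der_mp; [apply der_thm, Hab | apply der_add].
Qed.

Lemma ITL0_next_mono a b : ITL0 (Imp a b) -> ITL0 (Imp (Next a) (Next b)).
Proof. intros H. eapply r_mp; [apply ax_nextimp | apply r_nec, H]. Qed.

(** With [X] for [Or a (Next (Dia a))], the fixpoint axiom under [Next] gives [Next X -> X].
    Induction then gives [Dia X -> X], and monotonicity [Dia a -> Dia X]. *)
Lemma ITL0_dia_unfold a : ITL0 (Imp (Dia a) (Or a (Next (Dia a)))).
Proof.
  eapply ITL0_trans; [apply r_diamono, ipc6|].
  apply r_diaind. eapply ITL0_trans; [|apply ipc7].
  apply ITL0_next_mono, ax_diafix.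
Qed.

Definition nxt (G : form -> Prop) : form -> Prop := fun f => G (Next f).

(** Closure comes from necessitation and [ax_nextimp], consistency from [ax_nextbot], the
    disjunction property from [ax_nextor]. *)
Lemma prime_nxt G : prime G -> prime (nxt G).
Proof.
  intros P; split.
  - intros f D; unfold nxt. induction D as [f Hf|f Hf|f g _ IH1 _ IH2].
    + exact Hf.
    + apply prime_thm, r_nec, Hf; exact P.
    + eapply prime_mp; [exact P | | exact IH2].
      eapply prime_thm_mp; [exact P | apply ax_nextimp | exact IH1].
  - intros H. apply (prime_bot _ P).
    eapply prime_thm_mp; [exact P | apply ax_nextbot | exact H].
  - intros a b H. apply (prime_or _ P).
    eapply prime_thm_mp; [exact P | apply ax_nextor | exact H].
Qed.

(** * Finite conjunctions, disjunctions and subsets *)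

Definition bigand (l : list form) : form := fold_right And (Neg Bot) l.
Definition bigor (l : list form) : form := fold_right Or Bot l.

Lemma prime_bigand G l : prime G ->
  (G (bigand l) <-> forall f, In f l -> G f).
Proof.
  intros P; induction l as [|a l IH]; simpl.
  - split; [tauto|intros _]. apply prime_thm; [exact P | apply ipc9].
  - rewrite (prime_and_iff G a _ P), IH. split.
    + intros [Ha Hl] f [<-|Hf]; auto.
    + intros H; split; auto.
Qed.

Lemma prime_bigor G l : prime G ->
  (G (bigor l) <-> exists f, In f l /\ G f).
Proof.
  intros P; induction l as [|a l IH]; simpl.
  - split; [|intros (f & [] & _)]. intros H; destruct (prime_bot _ P H).
  - rewrite (prime_or_iff G a _ P), IH. split.
    + intros [Ha|(f & Hf & Gf)]; eauto.
    + intros (f & [<-|Hf] & Gf); eauto.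
Qed.

Fixpoint pow {A : Type} (l : list A) : list (list A) :=
  match l with
  | [] => [[]]
  | x :: l => pow l ++ map (cons x) (pow l)
  end.

(** Turns an arbitrary predicate into a list, by excluded middle at each element. *)
Lemma pow_comprehension {A : Type} (P : A -> Prop) (l : list A) :
  exists c, In c (pow l) /\ forall x, In x c <-> In x l /\ P x.
Proof.
  induction l as [|a l (c & Hc & Ec)]; simpl.
  - exists []; split; [auto | simpl; tauto].
  - destruct (classic (P a)) as [Pa|Na].
    + exists (a :: c); split.
      * apply in_or_app; right; apply in_map; exact Hc.
      * intros x; simpl; rewrite Ec. split; [intros [<-|?]|]; tauto.
    + exists c; split.
      * apply in_or_app; left; exact Hc.
      * intros x; rewrite Ec. split; [tauto|].
        intros [[<-|?] ?]; tauto.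
Qed.

Definition form_eq_dec (f g : form) : {f = g} + {f <> g}.
Proof. decide equality; apply Nat.eq_dec. Defined.

Definition diff (s l : list form) : list form :=
  filter (fun f => if in_dec form_eq_dec f l then false else true) s.

Lemma in_diff s l f : In f (diff s l) <-> In f s /\ ~ In f l.
Proof.
  unfold diff; rewrite filter_In. destruct (in_dec form_eq_dec f l); intuition discriminate.
Qed.

Lemma diff_length_mono s l l' : (forall f, In f s -> In f l -> In f l') ->
  length (diff s l') <= length (diff s l).
Proof.
  induction s as [|a s IH]; simpl; intros H; [auto|].
  specialize (IH (fun f Hf => H f (or_intror Hf))).
  unfold diff in *; simpl.
  destruct (in_dec form_eq_dec a l) as [Ha|Ha], (in_dec form_eq_dec a l') as [Ha'|Ha'];
    simpl; try lia.
  destruct (Ha' (H a (or_introl eq_refl) Ha)).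
Qed.

Lemma diff_length_strict s l l' a : (forall f, In f s -> In f l -> In f l') ->
  In a s -> ~ In a l -> In a l' ->
  length (diff s l') < length (diff s l).
Proof.
  induction s as [|b s IH]; simpl; intros H Hs Nl Hl'; [contradiction|].
  assert (H' := fun f Hf => H f (or_intror Hf)).
  destruct Hs as [->|Hs].
  - assert (M := diff_length_mono s l l' H'). unfold diff in *; simpl.
    destruct (in_dec form_eq_dec a l), (in_dec form_eq_dec a l'); simpl; try tauto; lia.
  - specialize (IH H' Hs Nl Hl'). unfold diff in *; simpl.
    destruct (in_dec form_eq_dec b l) as [Ha|Ha], (in_dec form_eq_dec b l') as [Ha'|Ha'];
      simpl; try lia.
    destruct (Ha' (H b (or_introl eq_refl) Ha)).
Qed.

Lemma sub_refl f : In f (sub f).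
Proof. destruct f; left; reflexivity. Qed.

Lemma sub_trans f g h : In g (sub f) -> In h (sub g) -> In h (sub f).
Proof.
  induction f; simpl; intros [<-|Hg] Hh; try (exact Hh); try contradiction;
    right; rewrite ?in_app_iff in *; intuition.
Qed.

(** * Trees of types *)

Inductive tree : Type := Node : list form -> list tree -> tree.

Definition lab (t : tree) : list form := let (l, _) := t in l.
Definition kids (t : tree) : list tree := let (_, cs) := t in cs.

Inductive subtree (t : tree) : tree -> Prop :=
| subtree_refl : subtree t t
| subtree_kid c u : In c (kids t) -> subtree c u -> subtree t u.

Lemma subtree_trans t u v : subtree t u -> subtree u v -> subtree t v.
Proof. induction 1; eauto using subtree_kid. Qed.

Inductive sim (Sig : list form) : tree -> (form -> Prop) -> Prop :=
| sim_node l cs G :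
    (forall f, In f Sig -> (In f l <-> G f)) ->
    (forall c, In c cs ->
       exists H, (prime H /\ forall f, G f -> H f) /\ sim Sig c H) ->
    sim Sig (Node l cs) G.

(** Forward confluence is built in: every child of [t] must step to some node of [u]. *)
Inductive step (Sig : list form) : tree -> tree -> Prop :=
| step_node t u :
    sens_T (fun f => In f Sig /\ ~ In f (lab t)) (fun f => In f (lab t))
           (fun f => In f Sig /\ ~ In f (lab u)) (fun f => In f (lab u)) ->
    (forall c, In c (kids t) -> exists v, subtree u v /\ step Sig c v) ->
    step Sig t u.

(** The rank of a label. It drops along every edge of a [wf] tree and so bounds the depth. *)
Definition miss (Sig l : list form) : nat := length (diff Sig l).

Fixpoint trees (Sig : list form) (n : nat) : list tree :=
  match n with
  | 0 => []
  | S n => trees Sig n ++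
      flat_map (fun l => map (Node l) (pow (trees Sig n))) (pow Sig)
  end.

Lemma trees_le Sig m n : m <= n -> forall t, In t (trees Sig m) -> In t (trees Sig n).
Proof. induction 1; simpl; auto using in_or_app. Qed.

(** [cs] is drawn from a finite stock of trees, so that [wf] leaves finitely
    many trees; growing labels make the stock of rank [miss Sig l] large enough
    to contain all admissible children. *)
Inductive wf (Sig : list form) : tree -> Prop :=
| wf_node l cs :
    In l (pow Sig) ->
    is_type Sig (fun f => In f Sig /\ ~ In f l) (fun f => In f l) ->
    In cs (pow (trees Sig (miss Sig l))) ->
    (forall c, In c cs -> wf Sig c) ->
    (forall c, In c cs -> incl l (lab c) /\ miss Sig (lab c) < miss Sig l) ->
    (forall a b, In (Imp a b) Sig -> ~ In (Imp a b) l ->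
       (In a l /\ ~ In b l) \/
       exists c, In c cs /\ In a (lab c) /\ ~ In b (lab c)) ->
    wf Sig (Node l cs).

Lemma wf_trees Sig t : wf Sig t -> In t (trees Sig (S (miss Sig (lab t)))).
Proof.
  intros [l cs Hl _ Hcs _ _ _]; simpl. apply in_or_app; right.
  apply in_flat_map; exists l; split; [exact Hl | apply in_map, Hcs].
Qed.

Lemma wf_in_trees Sig t : wf Sig t -> In t (trees Sig (S (length Sig))).
Proof.
  intros W. eapply trees_le; [|apply wf_trees, W].
  apply le_n_S, filter_length_le.
Qed.

Lemma wf_subtree Sig t u : subtree t u -> wf Sig t -> wf Sig u.
Proof.
  induction 1 as [|t c u Hc _ IH]; [auto|].
  intros W; apply IH. destruct W; auto.
Qed.

Lemma wf_subtree_lab Sig t u : subtree t u -> wf Sig t -> incl (lab t) (lab u).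
Proof.
  induction 1 as [|t c u Hc _ IH]; intros W; [apply incl_refl|].
  destruct W as [l cs _ _ _ Wc Mc _].
  apply incl_tran with (lab c); [apply Mc, Hc | apply IH, Wc, Hc].
Qed.

(** Serves antisymmetry: distinct trees cannot be subtrees of each other, since the rank would drop
    both ways. *)
Lemma wf_subtree_miss Sig t u : subtree t u -> wf Sig t ->
  t = u \/ miss Sig (lab u) < miss Sig (lab t).
Proof.
  induction 1 as [|t c u Hc _ IH]; intros W; [auto|right].
  destruct W as [l cs _ _ _ Wc Mc _].
  assert (M := proj2 (Mc c Hc)). simpl.
  destruct (IH (Wc c Hc)) as [->|]; lia.
Qed.

Lemma sim_subtree Sig t u G : subtree t u -> prime G -> sim Sig t G ->
  exists H, prime H /\ sim Sig u H.
Proof.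
  intros T; revert G; induction T as [|t c u Hc _ IH]; intros G P M; [eauto|].
  destruct M as [l cs G _ Hk]. destruct (Hk c Hc) as (H & [PH _] & M); eauto.
Qed.

Lemma step_subtree Sig t t' u : subtree t t' -> step Sig t u ->
  exists u', subtree u u' /\ step Sig t' u'.
Proof.
  intros T; revert u; induction T as [t|t c t' Hc _ IH]; intros u Hs.
  - exists u; split; [apply subtree_refl | exact Hs].
  - destruct Hs as [t u _ Hk]. destruct (Hk c Hc) as (v & Huv & Hv).
    destruct (IH v Hv) as (v' & Hvv' & Hv').
    exists v'; split; [eapply subtree_trans; eauto | exact Hv'].
Qed.

Lemma step_same_label Sig t u u' : wf Sig t -> step Sig t u ->
  (forall f, In f (lab u) <-> In f (lab u')) -> incl (kids u) (kids u') ->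
  step Sig t u'.
Proof.
  intros W; revert u; induction W as [l cs _ _ _ _ IH _ _]; intros u Hs El Hk.
  inversion Hs as [t0 u0 [H1 [H2 [H3 H4]]] Hc]; subst.
  constructor.
  - split; [|split; [|split]].
    + intros a H; apply El, H1, H.
    + intros a H; destruct (H2 a H) as [Ha Na].
      split; [exact Ha | intros Hu; apply Na, El, Hu].
    + intros a H N; apply El, H3; assumption.
    + intros a H; destruct (H4 a H) as [Ha Na].
      split; [exact Ha | intros Hu; apply Na, El, Hu].
  - simpl in *; intros c Hcc. destruct (Hc c Hcc) as (v & T & Hv).
    (* A witness equal to [u] is replaced by [u'] through the induction hypothesis; a proper one
       lies under a child shared with [u']. *)
    destruct T as [|k v Hku T].
    + exists u'; split; [apply subtree_refl | eauto].
    + exists v; split; [eapply subtree_kid; eauto | exact Hv].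
Qed.

(** * Characteristic formulas *)

(** A formula in the style of Jankov and de Jongh: a theory containing [l] refutes the consequent by
    omitting the rest of [Sig] and each child's [chi]. *)
Fixpoint chi (Sig : list form) (t : tree) : form :=
  match t with
  | Node l cs => Imp (bigand l) (Or (bigor (diff Sig l)) (bigor (map (chi Sig) cs)))
  end.

Lemma pow_incl {A : Type} (l c : list A) : In c (pow l) -> incl c l.
Proof.
  revert c; induction l as [|a l IH]; simpl; intros c H.
  - destruct H as [<-|[]]. apply incl_refl.
  - apply in_app_iff in H as [H|H]; [apply incl_tl; auto|].
    apply in_map_iff in H as (d & <- & Hd).
    apply incl_cons; [left; reflexivity | apply incl_tl; auto].
Qed.

(** A refuted implication has a prime extension with the antecedent and without the consequent,
    which is what simulation asks. Conversely, a simulating extension containing [chi] would contain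
    a disjunct, against its label or a child. *)
Lemma chi_spec Sig t : wf Sig t -> forall G, prime G ->
  (~ G (chi Sig t) <->
   exists H, prime H /\ (forall f, G f -> H f) /\ sim Sig t H).
Proof.
  induction 1 as [l cs Hl _ _ _ IH _ _]; intros G P; cbn [chi]; split.
  - intros N. destruct (prime_not_imp _ _ _ P N) as (H & PH & GH & Ha & Hb).
    exists H; split; [exact PH | split; [exact GH|]].
    rewrite prime_bigand in Ha by exact PH.
    rewrite prime_or_iff, !prime_bigor in Hb by exact PH.
    constructor.
    + intros f Hf; split; [apply Ha|]. intros Hh; apply NNPP; intros Nf.
      apply Hb; left; exists f; split; [apply in_diff; auto | exact Hh].
    + intros c Hc. assert (Nc : ~ H (chi Sig c)).
      { intros Hh; apply Hb; right; exists (chi Sig c); split; [apply in_map, Hc | exact Hh]. }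
      apply (IH c Hc H PH) in Nc as (K & PK & HK & M); eauto.
  - intros (H & PH & GH & M) HG. inversion M as [l0 cs0 H0 El Hk]; subst.
    assert (HA : H (bigand l)).
    { apply prime_bigand; [exact PH|]. intros f Hf.
      apply El; [eapply pow_incl; eauto | exact Hf]. }
    assert (HO := prime_mp _ _ _ PH (GH _ HG) HA).
    rewrite prime_or_iff, !prime_bigor in HO by exact PH.
    destruct HO as [(f & Hf & Hh)|(f & Hf & Hh)].
    + apply in_diff in Hf as [Hf Nf]. apply Nf, El; auto.
    + apply in_map_iff in Hf as (c & <- & Hc).
      destruct (Hk c Hc) as (K & [PK HK] & Mc).
      apply (IH c Hc H PH); eauto.
Qed.

(** * Saturated trees *)

Definition saturated (Sig : list form) (G : form -> Prop) (u : tree) : Prop :=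
  wf Sig u /\ sim Sig u G /\
  forall c H, wf Sig c -> miss Sig (lab c) < miss Sig (lab u) ->
    prime H -> (forall f, G f -> H f) -> sim Sig c H -> In c (kids u).

Definition sub_closed (Sig : list form) : Prop :=
  forall f g, In f Sig -> In g (sub f) -> In g Sig.

Lemma sub_closed_args Sig : sub_closed Sig ->
  (forall a b, In (And a b) Sig -> In a Sig /\ In b Sig) /\
  (forall a b, In (Or a b) Sig -> In a Sig /\ In b Sig) /\
  (forall a b, In (Imp a b) Sig -> In a Sig /\ In b Sig) /\
  (forall a, In (Next a) Sig -> In a Sig) /\
  (forall a, In (Dia a) Sig -> In a Sig).
Proof.
  intros C; repeat split; intros; eapply C; try eassumption; simpl;
    rewrite ?in_app_iff; auto using sub_refl.
Qed.

Lemma prime_is_type Sig G l : sub_closed Sig -> prime G ->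
  (forall f, In f l <-> In f Sig /\ G f) ->
  is_type Sig (fun f => In f Sig /\ ~ In f l) (fun f => In f l).
Proof.
  intros C P El. destruct (sub_closed_args _ C) as (CA & CO & CI & _ & CD).
  split.
  - tauto.
  - intros f Hf; apply El, Hf.
  - tauto.
  - intros f Hf. destruct (classic (In f l)); tauto.
  - rewrite El; intros [_ H]; exact (prime_bot _ P H).
  - intros a b H. rewrite !El, prime_and_iff by exact P. destruct (CA _ _ H). tauto.
  - intros a b H. rewrite !El, prime_or_iff by exact P. destruct (CO _ _ H). tauto.
  - intros a b H. rewrite El in H; destruct H as [H Hg].
    destruct (CI _ _ H). rewrite !El.
    destruct (classic (G a)) as [Ga|Na]; [right|tauto].
    split; [assumption | eapply prime_mp; eauto].
  - intros a [H N]. split; [auto|]. rewrite El in *. intros [_ Ga]; apply N.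
    split; [exact H|]. eapply prime_thm_mp; [exact P | apply ax_diafix|].
    apply prime_or_iff; auto.
Qed.

Lemma wf_sim_lab Sig t G : wf Sig t -> sim Sig t G ->
  forall f, In f (lab t) <-> In f Sig /\ G f.
Proof.
  intros [l cs Hl _ _ _ _ _] M f. inversion M as [l0 cs0 G0 El _]; subst; simpl.
  assert (I := pow_incl _ _ Hl f). split.
  - intros Hf; split; [auto | apply El; auto].
  - intros [Hs Hg]; apply El; auto.
Qed.

(** Induction on the rank of the type of [G]: take as children all [wf] trees of smaller rank
    simulated by prime extensions of [G]. They lie in a finite stock. *)
Lemma saturated_exists Sig G : sub_closed Sig -> prime G ->
  exists u, saturated Sig G u.
Proof.
  intros C P.
  destruct (pow_comprehension G Sig) as (l & Hl & El).
  remember (miss Sig l) as n eqn:En.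
  revert G P l Hl El En; induction n as [n IH] using lt_wf_ind; intros G P l Hl El En.
  set (K := fun c => wf Sig c /\ miss Sig (lab c) < n /\
              exists H, (prime H /\ forall f, G f -> H f) /\ sim Sig c H).
  destruct (pow_comprehension K (trees Sig n)) as (cs & Hcs & Ecs).
  assert (Kcs : forall c, In c cs <-> K c).
  { intros c; rewrite Ecs. split; [tauto|]. intros Kc; split; [|exact Kc].
    destruct Kc as (W & M & _).
    eapply trees_le; [exact M | apply wf_trees, W]. }
  assert (Hsim : sim Sig (Node l cs) G).
  { constructor.
    - intros f Hf; rewrite El; tauto.
    - intros c Hc; apply Kcs in Hc; apply Hc. }
  exists (Node l cs); split; [|split].
  - constructor.
    + exact Hl.
    + eapply prime_is_type; eauto.
    + subst n; exact Hcs.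
    + intros c Hc; apply Kcs in Hc; apply Hc.
    + intros c Hc; apply Kcs in Hc as (W & M & H & [PH GH] & Sc).
      split; [|lia]. intros f Hf. apply (wf_sim_lab _ _ _ W Sc).
      apply El in Hf as [Hs Hg]; auto.
    + intros a b Hi Ni. destruct (sub_closed_args _ C) as (_ & _ & CI & _).
      destruct (CI _ _ Hi) as [Sa Sb].
      assert (Ng : ~ G (Imp a b)) by (intros Hg; apply Ni, El; auto).
      destruct (prime_not_imp _ _ _ P Ng) as (H & PH & GH & Ha & Hb).
      (* If [a] is in [G], the root is the witness. Otherwise [a] is new in [H], the rank drops, and
         a saturated tree for [H] is the child wanted. *)
      destruct (classic (G a)) as [Ga|Na].
      * left; rewrite !El; split; [auto|]. intros [_ Gb]; apply Hb, GH, Gb.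
      * right. destruct (pow_comprehension H Sig) as (l' & Hl' & El').
        assert (M : miss Sig l' < n).
        { subst n; apply diff_length_strict with a.
          - intros f Hf Hfl; apply El'; apply El in Hfl as [_ Hg]; auto.
          - exact Sa.
          - rewrite El; tauto.
          - apply El'; auto. }
        destruct (IH _ M H PH l' Hl' El' eq_refl) as (c & W & Sc & _).
        assert (Ec := wf_sim_lab _ _ _ W Sc).
        exists c; split; [|rewrite !Ec; tauto].
        apply Kcs; split; [exact W | split; [|eauto]].
        assert (miss Sig (lab c) <= miss Sig l'); [|lia].
        apply diff_length_mono; intros f _; rewrite Ec, El'; tauto.
  - exact Hsim.
  - simpl; intros c H W M PH GH Sc. apply Kcs; split; [exact W | split; [lia | eauto]].
Qed.

Lemma prime_sens Sig G l l' : sub_closed Sig -> prime G ->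
  (forall f, In f l <-> In f Sig /\ G f) ->
  (forall f, In f l' <-> In f Sig /\ nxt G f) ->
  sens_T (fun f => In f Sig /\ ~ In f l) (fun f => In f l)
         (fun f => In f Sig /\ ~ In f l') (fun f => In f l').
Proof.
  intros C P El El'. destruct (sub_closed_args _ C) as (_ & _ & _ & CN & CD).
  unfold nxt in El'. repeat split.
  - intros a H. apply El in H as [H Hg]. apply El'; auto.
  - destruct H as [H _]; auto.
  - destruct H as [H N]. rewrite El' in *; rewrite El in N; tauto.
  - intros a H [_ N]. rewrite El in *; rewrite El'. destruct H as [H Hg].
    split; [exact H|].
    (* Since [a] is absent, unfolding [Dia a] leaves [Next (Dia a)]. *)
    assert (D := prime_thm_mp _ _ _ P (ITL0_dia_unfold a) Hg).
    apply (prime_or _ P) in D as [D|D]; [|exact D].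
    destruct N; auto.
  - apply H.
  - destruct H as [H N]. rewrite El' in *; rewrite El in N. intros [_ D]; apply N.
    split; [exact H|]. eapply prime_thm_mp; [exact P | apply ax_diafix|].
    apply prime_or_iff; auto.
Qed.

(** If the successor of an extension of [G] has the same type as that of [G],
    its saturated tree has no more children than [u], so [u] itself can serve
    as the target. *)
Lemma saturated_step Sig t : sub_closed Sig -> wf Sig t ->
  forall G u, prime G -> sim Sig t G -> saturated Sig (nxt G) u -> step Sig t u.
Proof.
  intros C W; induction W as [l cs Hl Ht Hcs Wc IH Mc Hi].
  assert (W : wf Sig (Node l cs)) by (constructor; auto).
  intros G u P M (Wu & Su & Ku).
  assert (Eu := wf_sim_lab _ _ _ Wu Su).
  constructor.
  - apply prime_sens with G; auto. apply wf_sim_lab; auto.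
  - simpl; intros c Hc. inversion M as [l0 cs0 G0 _ Hk]; subst.
    destruct (Hk c Hc) as (H & [PH GH] & Sc).
    assert (GH' : forall f, nxt G f -> nxt H f) by (intros f; apply GH).
    destruct (saturated_exists Sig (nxt H) C (prime_nxt _ PH)) as (v & Sv).
    assert (Hs := IH c Hc H v PH Sc Sv). destruct Sv as (Wv & Sv & _).
    assert (Ev := wf_sim_lab _ _ _ Wv Sv).
    (* A new formula in [v] lowers the rank, so saturation makes [v] a child of [u]. *)
    destruct (classic (exists f, In f (lab v) /\ ~ In f (lab u))) as [(f & Fv & Fu)|N].
    + exists v; split; [|exact Hs]. eapply subtree_kid; [|apply subtree_refl].
      apply Ku with (nxt H); auto using prime_nxt.
      apply diff_length_strict with f; auto.
      * intros g _; rewrite Eu, Ev; intuition.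
      * apply Ev, Fv.
    + assert (E : forall f, In f (lab v) <-> In f (lab u)).
      { intros f; split; [|rewrite Eu, Ev; intuition].
        intros Hf; apply NNPP; eauto. }
      exists u; split; [apply subtree_refl|].
      apply step_same_label with v; auto.
      intros d Hd.
      destruct Wv as [lv cv _ _ _ Wd Md _]; simpl in *.
      inversion Sv as [l1 cs1 G1 _ Hkv]; subst.
      destruct (Hkv d Hd) as (K & [PK HK] & Sd).
      apply Ku with K; auto.
      apply Nat.lt_le_trans with (miss Sig lv); [apply Md, Hd|].
      apply diff_length_mono; intros f _; apply E.
Qed.

(** * The quasimodel *)

Definition point (Sig : list form) : Type :=
  {t : tree | wf Sig t /\ exists G, prime G /\ sim Sig t G}.

Definition pt_tree {Sig} (w : point Sig) : tree := proj1_sig w.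

Lemma pt_tree_inj {Sig} (w v : point Sig) : pt_tree w = pt_tree v -> w = v.
Proof.
  destruct w as [t p], v as [u q]; simpl; intros ->. f_equal; apply proof_irrelevance.
Qed.

Lemma point_finite Sig : finite_type (point Sig).
Proof.
  (* Not every tree in the stock carries a point, but by proof irrelevance each carries at most
     one. *)
  assert (F : forall l, exists L : list (point Sig), forall w, In (pt_tree w) l -> In w L).
  { induction l as [|t l [L HL]]; [exists []; auto|].
    destruct (classic (exists w : point Sig, pt_tree w = t)) as [[v Ev]|N].
    - exists (v :: L); intros w [Ew|Hw]; [left; apply pt_tree_inj; congruence | right; auto].
    - exists L; intros w [Ew|Hw]; [exfalso; eauto | auto]. }
  destruct (F (trees Sig (S (length Sig)))) as [L HL].
  exists L; intros w; apply HL, wf_in_trees, (proj2_sig w).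
Qed.

Definition pt_le {Sig} (w v : point Sig) : Prop := subtree (pt_tree w) (pt_tree v).
Definition pt_step {Sig} (w v : point Sig) : Prop := step Sig (pt_tree w) (pt_tree v).
Definition pt_minus {Sig} (w : point Sig) (f : form) : Prop :=
  In f Sig /\ ~ In f (lab (pt_tree w)).
Definition pt_plus {Sig} (w : point Sig) (f : form) : Prop := In f (lab (pt_tree w)).

Lemma pt_subtree {Sig} (w : point Sig) u : subtree (pt_tree w) u ->
  exists v : point Sig, pt_tree v = u.
Proof.
  destruct w as [t (W & G & P & M)]; simpl; intros T.
  destruct (sim_subtree _ _ _ _ T P M) as (H & PH & MH).
  unshelve eexists (exist _ u _); [|reflexivity].
  split; [eapply wf_subtree; eauto | eauto].
Qed.

(** The simulation by [nxt G] is kept so that refutation of [psi] can be carried along steps in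
    [pt_omega]. *)
Lemma pt_step_sim {Sig} (w : point Sig) G : sub_closed Sig ->
  prime G -> sim Sig (pt_tree w) G ->
  exists v : point Sig, pt_step w v /\ sim Sig (pt_tree v) (nxt G).
Proof.
  intros C P M. assert (PN := prime_nxt _ P).
  destruct (saturated_exists Sig (nxt G) C PN) as (u & Hu).
  assert (Hs := saturated_step _ _ C (proj1 (proj2_sig w)) _ _ P M Hu).
  destruct Hu as (Wu & Su & _).
  exists (exist _ u (conj Wu (ex_intro _ _ (conj PN Su)))); auto.
Qed.

Lemma iter_rel_snoc {W : Type} (S : W -> W -> Prop) n w v u :
  iter_rel S n w v -> S v u -> iter_rel S (Datatypes.S n) w u.
Proof.
  revert w; induction n as [|n IH]; intros w; simpl.
  - intros -> H; eauto.
  - intros (x & Hx & Hv) H. exists x; split; [exact Hx | exact (IH x Hv H)].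
Qed.

Lemma pt_omega {Sig} (w : point Sig) a : sub_closed Sig -> pt_plus w (Dia a) ->
  exists n v, iter_rel pt_step n w v /\ pt_plus v a.
Proof.
  intros C HD. apply NNPP; intros N.
  destruct (point_finite Sig) as [L HL].
  destruct (pow_comprehension (fun v => exists n, iter_rel pt_step n w v) L)
    as (R & _ & ER).
  set (psi := bigand (map (fun v => chi Sig (pt_tree v)) R)).
  assert (Hpsi : forall G, prime G ->
    (~ G psi <-> exists v n H, iter_rel pt_step n w v /\ prime H /\
                   (forall f, G f -> H f) /\ sim Sig (pt_tree v) H)).
  { intros G P. unfold psi. rewrite prime_bigand by exact P. split.
    - intros H. apply NNPP; intros Nv. apply H; intros f Hf.
      apply in_map_iff in Hf as (v & <- & Hv). apply ER in Hv as [_ [n Hn]].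
      apply NNPP; intros Hc.
      apply (chi_spec _ _ (proj1 (proj2_sig v)) G P) in Hc as (H' & PH & GH & M).
      apply Nv; exists v, n, H'; auto.
    - intros (v & n & H & Hn & PH & GH & M) Hall.
      apply (proj2 (chi_spec _ _ (proj1 (proj2_sig v)) G P)); [eauto|].
      apply Hall, in_map_iff. exists v; split; [reflexivity | apply ER; eauto]. }
  (* A prime theory with [b] but without [psi] would have an extension lacking [b], although
     membership persists. *)
  assert (Himp : forall b, (forall G, prime G -> ~ G psi -> exists H, prime H /\
                     (forall f, G f -> H f) /\ ~ H b) -> ITL0 (Imp b psi)).
  { intros b Hb. apply completeness; intros G P. apply NNPP; intros Nb.
    destruct (prime_not_imp _ _ _ P Nb) as (H & PH & _ & Hhb & Np).
    destruct (Hb H PH Np) as (K & _ & HK & NK). auto. }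
  assert (Ind : ITL0 (Imp (Next psi) psi)).
  { apply Himp; intros G P Np.
    apply Hpsi in Np as (v & n & H & Hn & PH & GH & M); [|exact P].
    exists H; split; [exact PH | split; [exact GH|]].
    (* A successor of a reachable point is reachable, so [nxt H] refutes [psi]; that is, [H] lacks
       [Next psi]. *)
    destruct (pt_step_sim v H C PH M) as (u & Hu & Mu).
    change (~ nxt H psi). apply Hpsi; [apply prime_nxt, PH|].
    exists u, (S n), (nxt H). split; [eapply iter_rel_snoc; eauto|].
    split; [apply prime_nxt, PH | auto]. }
  assert (Hbase : ITL0 (Imp a psi)).
  { apply Himp; intros G P Np.
    apply Hpsi in Np as (v & n & H & Hn & PH & GH & M); [|exact P].
    exists H; split; [exact PH | split; [exact GH|]]. intros Ha.
    apply N; exists n, v; split; [exact Hn|].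
    apply (wf_sim_lab _ _ _ (proj1 (proj2_sig v)) M). split; [|exact Ha].
    apply (sub_closed_args _ C).
    destruct (proj2_sig w) as (W & K & PK & MK).
    apply (wf_sim_lab _ _ _ W MK), HD. }
  destruct (proj2_sig w) as (W & G & P & M).
  apply (Hpsi G P).
  (* [w] reaches itself in zero steps, so its theory refutes [psi], yet [Dia a] forces [psi]. *)
  - exists w, 0, G; simpl; auto.
  - eapply prime_thm_mp; [exact P | |apply (wf_sim_lab _ _ _ W M), HD].
    eapply ITL0_trans; [apply r_diamono, Hbase | apply r_diaind, Ind].
Qed.

Lemma point_quasimodel Sig : sub_closed Sig ->
  quasimodel Sig (point Sig) pt_le pt_step pt_minus pt_plus.
Proof.
  intros C; split.
  - intros w; apply subtree_refl.
  - intros u v w; apply subtree_trans.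
  - intros u v Huv Hvu; apply pt_tree_inj.
    apply (wf_subtree_miss Sig) in Huv as [|Huv]; [assumption| |apply (proj2_sig u)].
    apply (wf_subtree_miss Sig) in Hvu as [|Hvu]; [congruence| |apply (proj2_sig v)].
    lia.
  - intros [t [[l cs Hl Ht Hcs Wc Mc Hi] Hs]]; exact Ht.
  - intros w v f Hwv. apply (wf_subtree_lab Sig _ _ Hwv), (proj2_sig w).
  - intros w a b [Hs Nl].
    assert (W := proj1 (proj2_sig w)). change (proj1_sig w) with (pt_tree w) in W.
    assert (Sb : In b Sig) by (apply (sub_closed_args _ C) in Hs; apply Hs).
    destruct (pt_tree w) as [l cs] eqn:Et.
    inversion W as [l0 cs0 _ _ _ _ _ Hi]; subst.
    destruct (Hi a b Hs Nl) as [[Ha Hb]|(c & Hc & Ha & Hb)].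
    + exists w; unfold pt_le, pt_plus, pt_minus; rewrite Et.
      split; [apply subtree_refl | auto].
    + assert (T : subtree (pt_tree w) c).
      { rewrite Et. eapply subtree_kid; [exact Hc | apply subtree_refl]. }
      destruct (pt_subtree w c T) as [v <-].
      exists v; split; [exact T | split; [exact Ha | split; [exact Sb | exact Hb]]].
  - intros w. destruct (proj2_sig w) as (_ & G & P & M).
    destruct (pt_step_sim w G C P M) as (v & Hv & _); eauto.
  - intros w w' v Hle Hs.
    destruct (step_subtree _ _ _ _ Hle Hs) as (u & Hu & Hs').
    destruct (pt_subtree v u Hu) as [v' <-]; eauto.
  - intros w v Hs. inversion Hs as [t u H _]; exact H.
  - intros w a; apply pt_omega, C.
Qed.

Theorem theorem7p5 (phi : form) :
  ~ ITL0 phi ->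
  exists (W : Type) (le S : W -> W -> Prop) (lm lp : W -> form -> Prop),
    finite_type W /\ quasimodel (sub phi) W le S lm lp /\
    exists w : W, lm w phi.
Proof.
  intros N.
  assert (C : sub_closed (sub phi)) by (intros f g; apply sub_trans).
  exists (point (sub phi)), pt_le, pt_step, pt_minus, pt_plus.
  split; [apply point_finite | split; [apply point_quasimodel, C|]].
  destruct (lindenbaum (fun _ => False) phi) as (G & P & _ & NG).
  { intros D; apply N, der_empty, D. }
  (* The root label is the trace of [G] on [sub phi], so it omits [phi]. *)
  destruct (saturated_exists (sub phi) G C P) as (u & W & M & _).
  exists (exist _ u (conj W (ex_intro _ _ (conj P M)))).
  split; [apply sub_refl|]. simpl. rewrite (wf_sim_lab _ _ _ W M). tauto.
Qed.
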